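(* Let $D=(E,\mathcal{F})$ be a binary even delta-matroid. Then $D$ is bipartite if and only if the loop complementation $D+E$ is an even delta-matroid.
   Context: A set system is a pair $D=(E,\mathcal{F})$ with $E$ a finite set and $\mathcal{F}$ a collection of subsets of $E$ (the feasible sets); it is proper if $\mathcal{F}\neq\emptyset$. A delta-matroid is a proper set system satisfying the symmetric exchange axiom: for all $X,Y\in\mathcal{F}$ and $u\in X\Delta Y$ there is $v\in X\Delta Y$ (possibly $v=u$) such that $X\Delta\{u,v\}\in\mathcal{F}$, where $\Delta$ is symmetric difference. A delta-matroid is even if the sizes of its feasible sets all have the same parity. $D_{min}=(E,\mathcal{F}_{min})$, where $\mathcal{F}_{min}$ is the set of feasible sets of minimum cardinality. It is a matroid whose set of bases is $\mathcal{F}_{min}$ (the lower matroid of $D$). A matroid is bipartite if every circuit has even cardinality. A delta-matroid $D$ is bipartite if the matroid $D_{min}$ is bipartite. For $A\subseteq E$, the twist is $D*A=(E,\{A\Delta X: X\in\mathcal{F}\})$. For a symmetric matrix $A$ over $GF(2)$ with rows and columns indexed by $E$, let $A[X]$ be the principal submatrix on $X\subseteq E$ (with $A[\emptyset]$ nonsingular by convention), and let $D(A)=(E,\{X\subseteq E: A[X]\text{ is nonsingular}\})$, which is a delta-matroid. A delta-matroid is binary if it has a twist isomorphic to $D(A)$ for some symmetric matrix $A$ over $GF(2)$. For a set system $D=(E,\mathcal{F})$ and $e\in E$, $D+e=(E,\mathcal{F}')$ where $\mathcal{F}'=\mathcal{F}\,\Delta\,\{F\cup\{e\}: F\in\mathcal{F},\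 e\notin F\}$. One has $(D+e_1)+e_2=(D+e_2)+e_1$, so for $A=\{e_1,\dots,e_n\}\subseteq E$ the loop complementation of $D$ on $A$ is unambiguously defined by $D+A=D+e_1+\cdots+e_n$. *)

(* Defs.v *)
From mathcomp Require Import all_boot all_order all_algebra.

Set Implicit Arguments.
Unset Strict Implicit.
Unset Printing Implicit Defensive.

(* The ground set is the whole of the finite type E, so a set system on E is
   just its collection of feasible sets. *)
Definition set_system (E : finType) : Type := {set {set E}}.

Definition symdiff (T : finType) (A B : {set T}) : {set T} :=
  (A :\: B) :|: (B :\: A).

Notation "A :^^: B" := (symdiff A B) (at level 52, left associativity).

Definition delta_matroid (E : finType) (D : set_system E) : Prop :=
  D != set0 /\
  forall X Y : {set E}, X \in D -> Y \in D ->
  forall u : E, u \in X :^^: Y ->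
  exists2 v : E, v \in X :^^: Y & X :^^: [set u; v] \in D.

Definition even_system (E : finType) (D : set_system E) : Prop :=
  forall X Y : {set E}, X \in D -> Y \in D -> odd #|X| = odd #|Y|.

Definition lower (E : finType) (D : set_system E) : set_system E :=
  [set X in D | [forall Y in D, #|X| <= #|Y|]].

(* In the next three definitions B is the collection of bases of a matroid. *)
Definition independent (E : finType) (B : set_system E) (X : {set E}) : bool :=
  [exists Y in B, X \subset Y].

Definition circuit (E : finType) (B : set_system E) (C : {set E}) : bool :=
  minset (fun X => ~~ independent B X) C.

Definition bipartite_matroid (E : finType) (B : set_system E) : Prop :=
  forall C : {set E}, circuit B C -> ~~ odd #|C|.

Definition bipartite (E : finType) (D : set_system E) : Prop :=
  bipartite_matroid (lower D).

Definition twist (E : finType) (D : set_system E) (A : {set E}) :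
  set_system E := [set A :^^: X | X in D].

Definition isomorphic (E E' : finType) (D : set_system E)
    (D' : set_system E') : Prop :=
  exists2 f : E -> E', bijective f &
    forall X : {set E}, (X \in D) = (f @: X \in D').

Definition principal_submx (R : Type) (n : nat) (M : 'M[R]_n)
    (X : {set 'I_n}) : 'M[R]_#|X| :=
  mxsub (enum_val (A := X)) (enum_val (A := X)) M.

(* For X = set0 the principal submatrix has size 0 and belongs to unitmx, in
   accordance with the convention that it is nonsingular. *)
Definition matrix_system (n : nat) (M : 'M['F_2]_n) : set_system 'I_n :=
  [set X : {set 'I_n} | principal_submx M X \in unitmx].

(* Indexing M by 'I_n loses no generality, as D is only required to have a
   twist isomorphic to matrix_system M. *)
Definition binary (E : finType) (D : set_system E) : Prop :=
  exists (A : {set E}) (n : nat) (M : 'M['F_2]_n),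
    M^T%R = M /\ isomorphic (twist D A) (matrix_system M).

Definition loop_complement1 (E : finType) (D : set_system E) (e : E) :
  set_system E := D :^^: [set e |: X | X in D & e \notin X].

(* The elements of A are processed in the order of enum A; by
   loop_complement_perm below, any other order gives the same result. *)
Definition loop_complement (E : finType) (D : set_system E) (A : {set E}) :
  set_system E := foldl (@loop_complement1 E) D (enum A).

Lemma in_loop_complement1 (E : finType) (D : set_system E) (e : E)
    (X : {set E}) :
  (X \in loop_complement1 D e) = (X \in D) (+) ((e \in X) && (X :\ e \in D)).
Proof.
have -> : (e \in X) && (X :\ e \in D) =
          (X \in [set e |: Y | Y in D & e \notin Y]).
  apply/andP/imsetP => [[eX XD]|[Y]].
    by exists (X :\ e); rewrite ?setD1K // !inE eqxx XD.
  by rewrite inE => /andP[YD eY] ->; rewrite setU11 setU1K.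
by rewrite !inE; case: (X \in D); case: (X \in [set _ | _ in _]).
Qed.

Lemma loop_complement1C (E : finType) (D : set_system E) (e f : E) :
  loop_complement1 (loop_complement1 D e) f =
  loop_complement1 (loop_complement1 D f) e.
Proof.
have [-> //|nef] := eqVneq e f.
apply/setP => X; rewrite !in_loop_complement1 !in_setD1 nef eq_sym nef /=.
have -> : X :\ f :\ e = X :\ e :\ f by rewrite !setDDl setUC.
by do 2![case: (_ \in X)]; do 4![case: (_ \in D)].
Qed.

Lemma loop_complement_perm (E : finType) (D : set_system E) (A : {set E})
    (s : seq E) :
  perm_eq s (enum A) -> foldl (@loop_complement1 E) D s = loop_complement D A.
Proof.
rewrite /loop_complement; elim: s (enum A) D => [|x s IHs] t D.
  by rewrite perm_sym => /perm_nilP ->.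
move=> st; have xt : x \in t by rewrite -(perm_mem st) mem_head.
case/splitPr: t / xt st => t1 t2.
rewrite perm_sym (perm_catCA t1 [:: x] t2) /= perm_cons perm_sym.
move=> /IHs /= ->; rewrite !foldl_cat /=; congr foldl.
elim: t1 D {IHs} => //= y t1 IHt D.
by rewrite loop_complement1C IHt.
Qed.

(* Main.v *)
Require Import Defs.
From mathcomp Require Import all_boot all_order all_algebra.

(** A binary delta-matroid is encoded by a Lagrangian space, in the manner of
    Bouchet's isotropic systems.  Attach to every element e of E a copy of the
    symplectic plane GF(2)^2, whose three nonzero vectors pairwise have product
    1, and let L be a subspace of the sum of these planes that is totally
    isotropic of dimension |E|.  Given two distinct nonzero vectors a e and b e
    in each plane, declare X feasible when L meets trivially the span of the
    vectors a e (e in X) and b e (e not in X).  For L the graph of a symmetric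
    matrix and a, b the two coordinate axes this is the delta-matroid of the
    matrix ([feasible_graph]).  The gain is that L never changes: a twist on A
    swaps a and b on A ([twist_feasible]), and the loop complementation on E
    replaces a by the third vector a + b ([loop_complement_feasible]), because
    among the three choices of a vector in one plane, the others being fixed,
    either none or exactly two give a trivial intersection
    ([transverse_three]).

    For w in L let q_ab(w) be the number, modulo 2, of the e at which w is the
    third vector a e + b e.  On the isotropic space L the quadratic form q_ab
    is additive, and the system is even exactly when q_ab vanishes on L
    ([quad_eq0], [quad_even]).  For the loop complement the third vector is a
    instead of a + b.  So, when q_ab vanishes on L, the loop complement is even
    exactly when the number of e at which w is a e or a e + b e is even for
    every w in L ([quad_shadow]).  Those e form the shadow of w.

    The shadows form a vector space of subsets of E, and it is the cycle space
    of the lower matroid: the circuits are the minimal nonempty shadows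
    ([independent_shadow], [shadow_independent]), and a nonempty
    shadow shrinks when a circuit inside it is added to it.  Hence all shadows
    are even exactly when the lower matroid is bipartite
    ([bipartite_shadow]).  Finally, every nonempty system of this kind is a
    delta-matroid ([feasible_exchange]), which settles the loop complement. *)

Set Implicit Arguments.
Unset Strict Implicit.
Unset Printing Implicit Defensive.

Import GRing.Theory.
Local Open Scope ring_scope.

(** * The symplectic plane over GF(2) *)

Notation plane := ('F_2 * 'F_2)%type.

(** The determinant of v and w; the sign is immaterial in characteristic 2.
    It is 1 exactly when v and w are distinct and nonzero. *)
Definition cross (v w : plane) : 'F_2 := v.1 * w.2 + v.2 * w.1.

Lemma F2P (x : 'F_2) : x = 0 \/ x = 1.
Proof. by case: x => [[|[|[]]] // i]; [left|right]; apply: val_inj. Qed.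

Lemma F2_neq0 (x : 'F_2) : x != 0 -> x = 1.
Proof. by case: (F2P x) => ->. Qed.

Lemma F2_addxx (x : 'F_2) : x + x = 0.
Proof. by case: (F2P x) => ->; apply/eqP. Qed.

Lemma F2_natr_eq0 n : (n%:R == 0 :> 'F_2) = ~~ odd n.
Proof.
elim: n => [|n IHn]; first by rewrite eqxx.
by rewrite -natr1 /= -IHn; case: (F2P n%:R) => ->.
Qed.

Lemma planeP (P : plane -> Prop) :
  P (0, 0) -> P (0, 1) -> P (1, 0) -> P (1, 1) -> forall v, P v.
Proof. by move=> ? ? ? ? [x y]; case: (F2P x) => ->; case: (F2P y) => ->. Qed.

Lemma crossDl u v w : cross (u + v) w = cross u w + cross v w.
Proof. by rewrite /cross /= !mulrDl addrACA. Qed.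

Lemma crossC v w : cross v w = cross w v.
Proof. by rewrite /cross addrC mulrC [X in _ + X]mulrC. Qed.

Lemma crossDr u v w : cross u (v + w) = cross u v + cross u w.
Proof. by rewrite !(crossC u) crossDl. Qed.

Lemma crossvv v : cross v v = 0.
Proof. by rewrite /cross [X in _ + X]mulrC F2_addxx. Qed.

Lemma cross0 v : cross 0 v = 0.
Proof. by rewrite /cross !mul0r addr0. Qed.

Lemma cross_parallel t v w :
  t != 0 -> cross v t = 0 -> cross w t = 0 -> cross v w = 0.
Proof.
move: t v w; do 3 apply: planeP => //; move=> _ /eqP // _ /eqP //.
all: by move=> *; apply/eqP.
Qed.

Lemma cross_eq0 t t' v :
  cross t t' != 0 -> cross v t = 0 -> cross v t' = 0 -> v = 0.
Proof. by move: t t' v; do 3 apply: planeP => //; move=> _ /eqP // _ /eqP. Qed.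

(** The three-term Pluecker relation of four vectors in a plane, with the
    factor cross a b equal to 1.  It makes cross the polar form of the
    quadratic form v |-> cross v a * cross v b. *)
Lemma cross_pluecker a b v w :
  cross a b = 1 ->
  cross v a * cross w b + cross w a * cross v b = cross v w.
Proof.
by move: a b v w; do 4 apply: planeP => //; move=> /eqP // _; apply/eqP.
Qed.

(** * Lagrangian spaces and transversality *)

Lemma in_symdiff (T : finType) (A B : {set T}) x :
  (x \in A :^^: B) = (x \in A) (+) (x \in B).
Proof. by rewrite !inE; case: (x \in A); case: (x \in B). Qed.

Lemma symdiffK (T : finType) (A : {set T}) : involutive (symdiff A).
Proof. by move=> B; apply/setP => x; rewrite !in_symdiff addKb. Qed.

Section Lagrangian.

Variable E : finType.
Implicit Types (L : {set {ffun E -> plane}}) (v w : {ffun E -> plane}).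
Implicit Types (t a b : E -> plane) (X Y B : {set E}) (e u : E).

(** As L is closed under addition over GF(2), its cardinality encodes its
    dimension |E|, half of the dimension of the ambient space. *)
Record lagrangian L : Prop := Lagrangian {
  lagrangianD : {in L &, forall v w, v + w \in L};
  lagrangian_cross : {in L &, forall v w, \sum_e cross (v e) (w e) = 0};
  lagrangian_card : #|L| = (2 ^ #|E|)%N }.

(** When t e is nonzero this says that w e is 0 or t e, so that the w along a
    nowhere zero t form the span of the vectors t e. *)
Definition along t w : bool := [forall e, cross (w e) (t e) == 0].

Definition transverse L t : bool := [forall w in L, along t w ==> (w == 0)].

(** The analogue of the row of a matrix at u: when L is transverse to t, it is
    the graph of a linear map defined on a complement of the span of t, and w is
    the value at the basis vector of index u. *)
Definition fundamental t u w : Prop :=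
  forall e, cross (w e) (t e) = (e == u)%:R.

Definition choose X a b e : plane := if e \in X then a e else b e.

(** The value 1 forces a e and b e to be distinct and nonzero, so that
    0, a e, b e and a e + b e are the vectors of the plane at e. *)
Definition framed a b : Prop := forall e, cross (a e) (b e) = 1.

Definition feasible L a b : set_system E :=
  [set X | transverse L (choose X a b)].

Lemma alongP t w : reflect (forall e, cross (w e) (t e) = 0) (along t w).
Proof. apply: (iffP forallP) => h e; apply/eqP; exact: h. Qed.

Lemma transverseP L t :
  reflect (forall w, w \in L -> along t w -> w = 0) (transverse L t).
Proof.
apply: (iffP forall_inP) => h w wL; first by move/(implyP (h w wL))/eqP.
by apply/implyP => /(h w wL)->.
Qed.

Lemma eq_transverse L t t' : t =1 t' -> transverse L t = transverse L t'.
Proof.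
move=> tt'; apply: eq_forallb => w; congr (_ ==> (_ ==> _)).
by apply: eq_forallb => e; rewrite tt'.
Qed.

Lemma eq_feasible L a a' b b' :
  a =1 a' -> b =1 b' -> feasible L a b = feasible L a' b'.
Proof.
move=> aa' bb'; apply/setP => X; rewrite !inE; apply: eq_transverse => e.
by rewrite /choose aa' bb'.
Qed.

Lemma framed_choose a b X : framed a b -> framed (choose X b a) (choose X a b).
Proof. by move=> ab e; rewrite /choose; case: ifP; rewrite // crossC. Qed.

Lemma vec_addvv v : v + v = 0.
Proof. by apply/ffunP => e; rewrite !ffunE; congr pair; exact: F2_addxx. Qed.

Lemma vec_add_eq0 v w : v + w = 0 -> v = w.
Proof. by move=> vw; rewrite -[v]addr0 -(vec_addvv w) addrA vw add0r. Qed.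

(** Transversality makes w |-> (cross (w e) (t e))_e injective on L, hence
    bijective since L has as many elements as GF(2)^E. *)
Lemma fundamental_exists L t u :
  lagrangian L -> transverse L t -> exists2 w, w \in L & fundamental t u w.
Proof.
move=> lagL /transverseP trL.
pose p w : {ffun E -> 'F_2} := [ffun e => cross (w e) (t e)].
have p_inj : {in L &, injective p}.
  move=> v w vL wL /ffunP pvw; apply/vec_add_eq0/trL.
    exact: lagrangianD.
  apply/alongP => e; have := pvw e.
  by rewrite !ffunE crossDl => ->; rewrite F2_addxx.
have : p @: L == setT.
  rewrite eqEcard subsetT cardsT card_ffun card_in_imset //.
  by rewrite (lagrangian_card lagL) card_Fp //=.
move/eqP/setP/(_ [ffun e => (e == u)%:R]); rewrite inE => /imsetP[w wL pw].
by exists w => // e; move/ffunP/(_ e): pw; rewrite !ffunE.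
Qed.

Lemma transverse_neq0 L t e : lagrangian L -> transverse L t -> t e != 0.
Proof.
move=> lagL trL; have [w _ /(_ e)] := fundamental_exists e lagL trL.
by rewrite eqxx; apply: contra_eq_neq => ->; rewrite crossC cross0.
Qed.

(** Two vectors of L that both lie along t outside u have zero products there,
    so isotropy leaves only the term at u. *)
Lemma cross_off1 L t u v w :
    lagrangian L -> v \in L -> w \in L -> (forall e, t e != 0) ->
    (forall e, e != u -> cross (v e) (t e) = 0) ->
    (forall e, e != u -> cross (w e) (t e) = 0) ->
  cross (v u) (w u) = 0.
Proof.
move=> lagL vL wL t0 vt wt.
rewrite -(lagrangian_cross lagL vL wL) (bigD1 u) //= big1 ?addr0 // => e eu.
exact: (cross_parallel (t0 e) (vt e eu) (wt e eu)).
Qed.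

Lemma cross_off2 L t u u' v w :
    lagrangian L -> v \in L -> w \in L -> (forall e, t e != 0) -> u' != u ->
    (forall e, e != u -> e != u' -> cross (v e) (t e) = 0) ->
    (forall e, e != u -> e != u' -> cross (w e) (t e) = 0) ->
  cross (v u) (w u) = cross (v u') (w u').
Proof.
move=> lagL vL wL t0 u'u vt wt.
have := lagrangian_cross lagL vL wL.
rewrite (bigD1 u) //= (bigD1 u') //= big1 ?addr0 => [|e /andP[eu eu']].
  by case: (F2P (cross (v u) (w u))) => ->;
    case: (F2P (cross (v u') (w u'))) => -> // /eqP.
exact: (cross_parallel (t0 e) (vt e eu eu') (wt e eu eu')).
Qed.

(** Changing t at u only: every vector of L along t off u is a multiple of the
    fundamental vector w, so transversality depends on w u alone.  This is the
    1 by 1 pivot. *)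
Lemma pivot1 L t t' u w :
    lagrangian L -> transverse L t -> w \in L -> fundamental t u w ->
    (forall e, e != u -> t' e = t e) -> cross (t u) (t' u) = 1 ->
  transverse L t' = (cross (w u) (t' u) != 0).
Proof.
move=> lagL trt wL wF tt' tu; have t0 e := transverse_neq0 e lagL trt.
have wt e : e != u -> cross (w e) (t e) = 0 by rewrite wF => /negPf->.
apply/transverseP/idP => [trt' | wu v vL /alongP vt'].
  apply/eqP => wu; have w0 : w = 0.
    apply: trt' => //; apply/alongP => e.
    by have [-> //|eu] := eqVneq e u; rewrite tt' ?wt.
  by move: (wF u); rewrite w0 ffunE cross0 eqxx => /eqP.
have vt e : e != u -> cross (v e) (t e) = 0 by move=> eu; rewrite -tt'.
have vu : v u = 0.
  exact: (cross_eq0 wu (cross_off1 lagL vL wL t0 vt wt) (vt' u)).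
move/transverseP: trt; apply=> //; apply/alongP => e.
by have [->|/vt//] := eqVneq e u; rewrite vu cross0.
Qed.

(** The 2 by 2 pivot: a principal submatrix with a zero diagonal entry at u and
    a nonzero entry at (u, u') is nonsingular, whatever is at (u', u'). *)
Lemma pivot2 L t t' u u' w :
    lagrangian L -> transverse L t -> w \in L -> fundamental t u w ->
    u' != u -> (forall e, e != u -> e != u' -> t' e = t e) ->
    cross (t' u) (t u) = 1 -> cross (t' u') (t u') = 1 ->
    cross (w u) (t' u) = 0 -> w u' != 0 ->
  transverse L t'.
Proof.
move=> lagL trt wL wF u'u tt' tu tu' wu wu'.
have t0 e := transverse_neq0 e lagL trt.
have wt e : e != u -> cross (w e) (t e) = 0 by rewrite wF => /negPf->.
apply/transverseP => v vL /alongP vt'.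
have vt e : e != u -> e != u' -> cross (v e) (t e) = 0.
  by move=> eu eu'; rewrite -tt'.
have t'u0 : t' u != 0 by apply: contra_eq_neq tu => ->; rewrite cross0.
(* At u both v and w are multiples of t' u, so isotropy makes the term at u'
   vanish as well. *)
have vwu' : cross (v u') (w u') = 0.
  rewrite -(cross_off2 lagL vL wL t0 u'u) // => [|e eu _]; last exact: wt.
  exact: (cross_parallel t'u0 (vt' u) wu).
have vu' : v u' = 0.
  have vtu' := cross_parallel wu' vwu' (etrans (crossC _ _) (wt _ u'u)).
  by apply: cross_eq0 (vt' u') vtu'; rewrite tu'.
have {}vt e : e != u -> cross (v e) (t e) = 0.
  by move=> eu; have [->|/vt->//] := eqVneq e u'; rewrite vu' cross0.
have [vu|vu] := eqVneq (cross (v u) (t u)) 0.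
  move/transverseP: trt; apply=> //; apply/alongP => e.
  by have [->|/vt] := eqVneq e u.
have vw : v = w.
  apply/vec_add_eq0; move/transverseP: trt; apply; first exact: lagrangianD.
  apply/alongP => e; rewrite ffunE crossDl.
  have [->|eu] := eqVneq e u; last by rewrite vt ?wt ?addr0.
  by rewrite wF eqxx (F2_neq0 vu); apply/eqP.
by rewrite -vw vu' eqxx in wu'.
Qed.

(** * Feasible sets: pivoting, exchange and parity *)

Lemma choose_symdiff a b X Y e :
  choose (X :^^: Y) a b e = if e \in Y then choose X b a e else choose X a b e.
Proof.
by rewrite /choose in_symdiff; case: (e \in X); case: (e \in Y).
Qed.

Lemma feasible_pivot1 L a b X u w :
    lagrangian L -> framed a b -> X \in feasible L a b -> w \in L ->
    fundamental (choose X a b) u w ->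
  (X :^^: [set u] \in feasible L a b) = (cross (w u) (choose X b a u) != 0).
Proof.
rewrite !inE => lagL ab XF wL wF.
rewrite (pivot1 (t' := choose (X :^^: [set u]) a b) lagL XF wL wF).
- by rewrite choose_symdiff inE eqxx.
- by move=> e /negPf eu; rewrite choose_symdiff inE eu.
by rewrite choose_symdiff inE eqxx crossC framed_choose.
Qed.

Lemma feasible_pivot2 L a b X (u v : E) w :
    lagrangian L -> framed a b -> X \in feasible L a b -> w \in L ->
    fundamental (choose X a b) u w ->
    X :^^: [set u] \notin feasible L a b -> v != u -> w v != 0 ->
  X :^^: [set u; v] \in feasible L a b.
Proof.
move=> lagL ab XF wL wF; rewrite (feasible_pivot1 lagL ab XF wL wF) negbK.
rewrite !inE in XF *; move=> /eqP wu vu wv.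
have tE e : choose (X :^^: [set u; v]) a b e =
    if (e == u) || (e == v) then choose X b a e else choose X a b e.
  by rewrite choose_symdiff !inE.
apply: (pivot2 lagL XF wL wF vu _ _ _ _ wv) => [e /negPf eu /negPf ev|||].
- by rewrite tE eu ev.
- by rewrite tE eqxx framed_choose.
- by rewrite tE eqxx orbT framed_choose.
by rewrite tE eqxx.
Qed.

(** If the 1 by 1 pivot at u fails, the fundamental vector w at u must be
    nonzero at some other v in the symmetric difference, since otherwise w
    would lie in the span belonging to Y; then the 2 by 2 pivot on u and v
    succeeds. *)
Lemma feasible_exchange L a b :
    lagrangian L -> framed a b ->
  forall X Y, X \in feasible L a b -> Y \in feasible L a b ->
  forall u, u \in X :^^: Y ->
  exists2 v : E, v \in X :^^: Y & X :^^: [set u; v] \in feasible L a b.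
Proof.
move=> lagL ab X Y XF YF u uXY.
have [XuF|XuF] := boolP (X :^^: [set u] \in feasible L a b).
  by exists u; rewrite // setUid.
have XF' := XF; rewrite inE in XF'.
have [w wL wF] := fundamental_exists u lagL XF'.
have [v /and3P[vXY vu wv]|w0] :=
    pickP [pred v : E | [&& v \in X :^^: Y, v != u & w v != 0]].
  by exists v => //; apply: feasible_pivot2 wv.
move: YF; rewrite inE => /transverseP/(_ w wL) w_eq0.
suff /w_eq0 w00 : along (choose Y a b) w.
  by have := wF u; rewrite w00 ffunE cross0 eqxx => /eqP.
apply/alongP => e.
have -> : choose Y a b e =
    if e \in X :^^: Y then choose X b a e else choose X a b e.
  by rewrite -choose_symdiff symdiffK.
have [->|eu] := eqVneq e u; rewrite ?uXY.
  by move: XuF; rewrite (feasible_pivot1 lagL ab XF wL wF) negbK => /eqP.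
case: ifP => eXY; last by rewrite wF (negPf eu).
by have := w0 e; rewrite /= eXY eu /= => /negbFE/eqP->; rewrite cross0.
Qed.

Lemma odd_symdiff1 X u : odd #|X :^^: [set u]| = ~~ odd #|X|.
Proof.
rewrite (cardsD1 u X) (cardsD1 u (X :^^: [set u])) in_symdiff !inE eqxx.
have -> : (X :^^: [set u]) :\ u = X :\ u.
  by apply/setP => e; rewrite !inE; case: (e == u); case: (e \in X).
by case: (u \in X); rewrite /= ?add0n ?negbK.
Qed.

(** For framed a and b, the number modulo 2 of the e at which w e is the third
    vector a e + b e. *)
Definition quad a b w : 'F_2 := \sum_e cross (w e) (a e) * cross (w e) (b e).

Lemma quadD L a b v w :
    lagrangian L -> framed a b -> v \in L -> w \in L ->
  quad a b (v + w) = quad a b v + quad a b w.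
Proof.
move=> lagL ab vL wL; rewrite -[RHS]addr0 -(lagrangian_cross lagL vL wL).
rewrite /quad -!big_split /=; apply: eq_bigr => e _.
rewrite ffunE !crossDl -(cross_pluecker (v e) (w e) (ab e)).
by rewrite mulrDl !mulrDr [X in _ + X = _]addrC addrACA.
Qed.

(** Off u one factor of each term vanishes.  The remaining value is the
    diagonal entry at u of the matrix that represents L at X. *)
Lemma quad_fundamental a b X u w :
    fundamental (choose X a b) u w ->
  quad a b w = cross (w u) (choose X b a u).
Proof.
move=> wF; have qE e : cross (w e) (a e) * cross (w e) (b e) =
    cross (w e) (choose X a b e) * cross (w e) (choose X b a e).
  by rewrite /choose; case: ifP; rewrite // mulrC.
rewrite /quad (bigD1 u) //= big1 => [|e /negPf eu]; rewrite qE wF ?eu ?mul0r //.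
by rewrite eqxx mul1r addr0.
Qed.

(** In an even system no 1 by 1 pivot succeeds, so quad vanishes on the
    fundamental vectors; these span L, and quad is additive on L.  The
    induction removes one fundamental vector at a time from v. *)
Lemma quad_eq0 L a b :
    lagrangian L -> framed a b -> feasible L a b != set0 ->
    even_system (feasible L a b) ->
  {in L, forall w, quad a b w = 0}.
Proof.
move=> lagL ab /set0Pn[X XF] evD v vL.
have XF' := XF; rewrite inE in XF'; pose t := choose X a b.
have [n] := ubnP #|[set e | cross (v e) (t e) != 0]|.
elim: n v vL => // n IHn v vL vn.
have [u vu|v0] := pickP [pred e | cross (v e) (t e) != 0]; last first.
  have -> : v = 0.
    move/transverseP: XF'; apply=> //; apply/alongP => e.
    by apply/eqP/negbFE/v0.
  by rewrite /quad big1 // => e _; rewrite ffunE cross0 mul0r.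
have [w wL wF] := fundamental_exists u lagL XF'.
have vwL := lagrangianD lagL vL wL.
have -> : v = (v + w) + w by rewrite -addrA vec_addvv addr0.
rewrite (quadD lagL ab) // IHn ?add0r // ?(quad_fundamental wF).
  apply/eqP/negPn; rewrite -(feasible_pivot1 lagL ab XF wL wF).
  by apply/negP => /(evD X _ XF); rewrite odd_symdiff1; case: odd.
apply: leq_trans (ltnSE vn); apply: proper_card; apply/properP; split.
  apply/subsetP => e; rewrite !inE ffunE crossDl wF.
  by have [->|_] := eqVneq e u; rewrite ?addr0.
exists u; rewrite !inE // ffunE crossDl wF eqxx negbK.
by rewrite (F2_neq0 vu).
Qed.

(** When quad vanishes on L every 1 by 1 pivot fails, so the exchanges that
    lead from X to Y always use two distinct elements. *)
Lemma quad_even L a b :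
    lagrangian L -> framed a b -> {in L, forall w, quad a b w = 0} ->
  even_system (feasible L a b).
Proof.
move=> lagL ab q0 X Y XF YF.
have no_pivot1 Z u : Z \in feasible L a b ->
    Z :^^: [set u] \notin feasible L a b.
  move=> ZF; have ZF' := ZF; rewrite inE in ZF'.
  have [w wL wF] := fundamental_exists u lagL ZF'.
  rewrite (feasible_pivot1 lagL ab ZF wL wF) negbK.
  by rewrite -(quad_fundamental wF) q0.
have [n] := ubnP #|X :^^: Y|; elim: n X XF => // n IHn X XF XYn.
have [XY0|[u uXY]] := set_0Vmem (X :^^: Y).
  by rewrite -[Y](symdiffK X) XY0 /symdiff setD0 set0D setU0.
have [v vXY XuvF] := feasible_exchange lagL ab XF YF uXY.
have vu : v != u.
  by apply: contraTneq XuvF => ->; rewrite setUid no_pivot1.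
have uvE : X :^^: [set u; v] = X :^^: [set u] :^^: [set v].
  apply/setP => e; rewrite !in_symdiff !inE.
  by case: eqVneq => [->|_] /=; rewrite 1?eq_sym ?(negPf vu) ?addbF.
rewrite -(IHn _ XuvF); first by rewrite uvE !odd_symdiff1 negbK.
apply: leq_trans (ltnSE XYn); apply: proper_card; apply/properP; split.
  apply/subsetP => e; rewrite !in_symdiff !inE; move: uXY vXY.
  rewrite !in_symdiff; have [->|_] := eqVneq e u; first by [].
  by have [->|_] := eqVneq e v; rewrite //= addbF.
by exists u; rewrite // !in_symdiff !inE eqxx addbAC -in_symdiff uXY.
Qed.

(** If L is transverse to one of the three choices at u, the fundamental
    vector at u is parallel to exactly one of the other two, and by [pivot1]
    this is the one at which transversality fails. *)
Lemma transverse_three L t1 t2 t3 u :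
    lagrangian L -> (forall e, e != u -> t2 e = t1 e) ->
    (forall e, e != u -> t3 e = t1 e) ->
    t3 u = t1 u + t2 u -> cross (t1 u) (t2 u) = 1 ->
  transverse L t3 = transverse L t1 (+) transverse L t2.
Proof.
move=> lagL t21 t31 t3u t12.
(* The claim when the first choice is transverse; it then applies to all
   permutations of the three choices. *)
have other s1 s2 s3 : transverse L s1 ->
    (forall e, e != u -> s2 e = s1 e) -> (forall e, e != u -> s3 e = s1 e) ->
    s3 u = s1 u + s2 u -> cross (s1 u) (s2 u) = 1 ->
    transverse L s3 = ~~ transverse L s2.
  move=> tr1 s21 s31 s3u s12.
  have [w wL wF] := fundamental_exists u lagL tr1.
  rewrite (pivot1 lagL tr1 wL wF s21 s12) (pivot1 lagL tr1 wL wF s31).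
    by rewrite s3u crossDr wF eqxx; case: (F2P (cross (w u) (s2 u))) => ->.
  by rewrite s3u crossDr crossvv add0r.
have [tr1|tr1] := boolP (transverse L t1).
  by rewrite (other _ _ _ tr1 t21 t31).
have [tr2|tr2] := boolP (transverse L t2).
  rewrite (other t2 t1 t3) ?tr1 //; try by move=> e eu; rewrite t21 ?t31.
    by rewrite addrC.
  by rewrite crossC.
apply: contraNF tr1 => tr3; rewrite (other t3 t2 t1) //.
- by move=> e eu; rewrite t21 ?t31.
- by move=> e eu; rewrite t31.
- by rewrite t3u -addrA [X in _ + X](_ : _ = 0) ?addr0 //; congr pair;
    exact: F2_addxx.
by rewrite t3u crossDl t12 crossvv addr0.
Qed.

(** * Loop complementation and twists of feasible systems *)

Lemma loop_complement1_feasible L a b u :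
    lagrangian L -> framed a b ->
  loop_complement1 (feasible L a b) u =
  feasible L (fun e => if e == u then a e + b e else a e) b.
Proof.
move=> lagL ab; apply/setP => X; rewrite in_loop_complement1 !inE.
have [uX|uX] := boolP (u \in X); rewrite /= ?addbF; last first.
  apply: eq_transverse => e; rewrite /choose.
  by have [->|//] := eqVneq e u; rewrite (negPf uX).
apply/esym/(transverse_three (u := u)) => //.
- by move=> e eu; rewrite /choose !inE eu.
- by move=> e eu; rewrite /choose (negPf eu).
- by rewrite /choose !inE eqxx uX.
by rewrite /choose !inE eqxx uX.
Qed.

Lemma loop_complement_feasible L a b :
    lagrangian L -> framed a b ->
  loop_complement (feasible L a b) [set: E] =
  feasible L (fun e => a e + b e) b.
Proof.
move=> lagL; rewrite /loop_complement.
suff gen s : uniq s -> forall a, framed a b ->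
    foldl (@loop_complement1 E) (feasible L a b) s =
    feasible L (fun e => if e \in s then a e + b e else a e) b.
  move=> ab; rewrite gen ?enum_uniq //; apply: eq_feasible => // e.
  by rewrite mem_enum inE.
elim: s => [|u s IHs] /= => [_|/andP[us s_uniq]] a' ab'.
  exact: eq_feasible.
rewrite loop_complement1_feasible // IHs //.
  apply: eq_feasible => // e; rewrite inE.
  by have [->|//] := eqVneq e u; rewrite (negPf us).
by move=> e; case: ifP => // _; rewrite crossDl crossvv addr0.
Qed.

Lemma twist_feasible L a b A :
  twist (feasible L a b) A = feasible L (choose A b a) (choose A a b).
Proof.
apply/setP => X; rewrite -{1}(symdiffK A X) mem_imset; last first.
  exact: inv_inj (symdiffK A).
rewrite !inE; apply: eq_transverse => e.
by rewrite /choose in_symdiff; case: (e \in A); case: (e \in X).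
Qed.

Lemma twistK (D : set_system E) A : twist (twist D A) A = D.
Proof.
rewrite /twist -imset_comp -[RHS]imset_id; apply: eq_imset => X.
exact: symdiffK.
Qed.

(** When X is feasible, X :\ u survives complementation at u if it is feasible,
    and otherwise X survives. *)
Lemma loop_complement_neq0 (D : set_system E) A :
  D != set0 -> loop_complement D A != set0.
Proof.
rewrite /loop_complement; elim: (enum A) D => //= u s IHs D /set0Pn[X XD].
apply: IHs; apply/set0Pn; exists (if X :\ u \in D then X :\ u else X).
by case: ifP => XuD; rewrite in_loop_complement1 ?XuD ?setD11 // XD andbF.
Qed.

(** * Bipartite lower matroids *)

(** The support of the image of w in the quotient by the lines spanned by the
    b e; when L is a graph and b e the second axis, the support of the first
    components. *)
Definition shadow b w : {set E} := [set e | cross (w e) (b e) != 0].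

(** In matrix terms: since no proper subset of B is feasible, neither a 1 by 1
    nor a 2 by 2 pivot inside B succeeds, so the block of the matrix on B is
    zero. *)
Lemma lower_cross_eq0 L a b B u w :
    lagrangian L -> framed a b -> B \in lower (feasible L a b) ->
    u \in B -> w \in L -> fundamental (choose B a b) u w ->
  {in B, forall v : E, cross (w v) (b v) = 0}.
Proof.
rewrite inE => lagL ab /andP[BF /forall_inP Bmin] uB wL wF v vB.
have proper_infeasible (A : {set E}) : A \proper B -> A \notin feasible L a b.
  by move=> /proper_card; rewrite ltnNge; apply: contra => /Bmin.
have Bu : B :^^: [set u] \notin feasible L a b.
  apply: proper_infeasible; rewrite /symdiff.
  have /eqP-> : [set u] :\: B == set0 by rewrite setD_eq0 sub1set.
  by rewrite setU0 properD1.
have [->|vu] := eqVneq v u.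
  move: Bu; rewrite (feasible_pivot1 lagL ab BF wL wF) negbK.
  by rewrite /choose uB => /eqP.
have [->|wv] := eqVneq (w v) 0; first exact: cross0.
have /proper_infeasible/negP[] : B :^^: [set u; v] \proper B.
  have uvB : [set u; v] \subset B by rewrite subUset !sub1set uB.
  have /eqP E0 : [set u; v] :\: B == set0 by rewrite setD_eq0.
  rewrite /symdiff E0 setU0; apply/properP; split; first exact: subsetDl.
  by exists u; rewrite // !inE eqxx.
exact: feasible_pivot2 wv.
Qed.

(** Pair w with the fundamental vector v at an element u of a minimal feasible
    set B containing X: v vanishes on the rest of B, and off B both vectors are
    multiples of b, so isotropy makes the term at u vanish too, that is, u is
    not in the shadow. *)
Lemma independent_shadow L a b X w :
    lagrangian L -> framed a b -> independent (lower (feasible L a b)) X ->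
    w \in L -> shadow b w \subset X ->
  shadow b w = set0.
Proof.
move=> lagL ab /exists_inP[B BF XB] wL wX; apply/setP => u; rewrite [RHS]inE.
apply/negP => uw; have uB := subsetP XB _ (subsetP wX _ uw).
have BF' := BF; rewrite !inE in BF'; case/andP: BF' => BF' _.
have [v vL vF] := fundamental_exists u lagL BF'.
have v_b := lower_cross_eq0 lagL ab BF uB vL vF.
have b0 e : b e != 0.
  by apply: contra_eq_neq (ab e) => ->; rewrite crossC cross0.
have vwu : cross (v u) (w u) = 0.
  apply: (etrans _ (lagrangian_cross lagL vL wL)).
  rewrite (bigD1 u) //= big1 ?addr0 // => e eu.
  have ve : cross (v e) (choose B a b e) = 0 by rewrite vF (negPf eu).
  have [eB|eB] := boolP (e \in B); rewrite /choose ?eB ?(negPf eB) in ve.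
    have -> : v e = 0; last exact: cross0.
    by apply: cross_eq0 ve (v_b e eB); rewrite ab.
  apply: cross_parallel (b0 e) ve _; apply/eqP.
  apply: contraNT eB => we; apply/(subsetP XB)/(subsetP wX); by rewrite inE.
have vu0 : v u != 0.
  by apply: contra_eq_neq (vF u) => ->; rewrite cross0 eqxx.
move: uw; rewrite inE; case/eqP; apply: cross_parallel vu0 _ _.
  by rewrite crossC.
by rewrite crossC v_b.
Qed.

(** Take a minimal feasible B that meets X in as many elements as possible.
    For u in X but not in B, the shadow of the fundamental vector w at u is the
    fundamental circuit of u: it is contained in B with u added.  It is not
    contained in X, so it has an element v in B but not in X, and exchanging v
    for u contradicts the choice of B. *)
Lemma shadow_independent L a b X :
    lagrangian L -> framed a b -> feasible L a b != set0 ->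
    {in L, forall w, shadow b w \subset X -> shadow b w = set0} ->
  independent (lower (feasible L a b)) X.
Proof.
move=> lagL ab /set0Pn[B1 B1F] X_ind.
have [B0 B0F] : exists B0, B0 \in lower (feasible L a b).
  case: (arg_minnP (fun B : {set E} => #|B|) B1F) => B0 B0F B0min.
  by exists B0; rewrite inE; apply/andP; split; last apply/forall_inP.
case: (arg_maxnP (fun B : {set E} => #|B :&: X|) B0F) => B BF Bmax.
apply/exists_inP; exists B => //; apply/subsetP => u uX.
apply: contraT => uB; have BL : B \in lower (feasible L a b) := BF.
move: (BL); rewrite inE => /andP[{}BF /forall_inP Bmin].
have BF' := BF; rewrite inE in BF'.
have [w wL wF] := fundamental_exists u lagL BF'.
have uw : u \in shadow b w.
  by have := wF u; rewrite inE /choose (negPf uB) eqxx => ->.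
have /subsetPn[v vw vX] : ~~ (shadow b w \subset X).
  by apply: contraTN uw => /(X_ind w wL)->; rewrite inE.
have vu : v != u by apply: contraNneq vX => ->.
have vB : v \in B.
  move: vw; rewrite inE; apply: contraNT => vB.
  by have := wF v; rewrite /choose (negPf vB) (negPf vu) => ->.
have [x xL xF] := fundamental_exists v lagL BF'.
have xv := lower_cross_eq0 lagL ab BL vB xL xF vB.
(* The off-diagonal entries at (u, v) and at (v, u) agree, by isotropy. *)
have xu : x u != 0.
  apply: contraTneq vw => xu; rewrite inE negbK.
  have uv : u != v by rewrite eq_sym.
  have := cross_off2 lagL wL xL (fun e => transverse_neq0 e lagL BF') uv.
  rewrite xu [cross (w u) 0]crossC cross0.
  move=> wxv; apply/eqP; apply: cross_parallel (_ : x v != 0) _ _.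
  - by apply: contra_eq_neq (xF v) => ->; rewrite cross0 eqxx.
  - apply: wxv => e ev eu; first by rewrite wF (negPf eu).
    by rewrite xF (negPf ev).
  by rewrite crossC.
have Bv : B :^^: [set v] \notin feasible L a b.
  by rewrite (feasible_pivot1 lagL ab BF xL xF) negbK /choose vB xv.
have uv : u != v by rewrite eq_sym.
have CF := feasible_pivot2 lagL ab BF xL xF Bv uv xu.
have CE : B :^^: [set v; u] = u |: (B :\ v).
  apply/setP => e; rewrite in_symdiff !inE.
  have [->|_] := eqVneq e u; first by rewrite (negPf uB) orbT.
  by have [->|_] := eqVneq e v; rewrite ?vB //= addbF.
have Cu : u \notin B :\ v by rewrite !inE (negPf uB) andbF.
have CL : u |: (B :\ v) \in lower (feasible L a b).
  rewrite inE -CE CF CE /=; apply/forall_inP => Y YF; rewrite cardsU1 Cu.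
  by have := Bmin Y YF; rewrite (cardsD1 v B) vB.
have := Bmax _ CL; rewrite /= leqNgt => /negP[].
apply: proper_card; apply/properP; split.
  apply/subsetP => e; rewrite !inE => /andP[eB eX]; rewrite eX eB !andbT.
  by rewrite (contraNneq _ vX) ?orbT // => <-.
by exists u; rewrite !inE ?eqxx ?uX ?(negPf uB).
Qed.

Lemma shadowD b v w : shadow b (v + w) = shadow b v :^^: shadow b w.
Proof.
apply/setP => e; rewrite in_symdiff !inE ffunE crossDl.
by case: (F2P (cross (v e) (b e))) => ->; case: (F2P (cross (w e) (b e))) => ->.
Qed.

(** Every circuit is a shadow.  Conversely a nonempty shadow is dependent, and
    removing from it a circuit that it contains leaves a smaller shadow of the
    same parity when the circuit is even. *)
Lemma bipartite_shadow L a b :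
    lagrangian L -> framed a b -> feasible L a b != set0 ->
  bipartite (feasible L a b) <-> {in L, forall w, ~~ odd #|shadow b w|}.
Proof.
move=> lagL ab D0; split=> [bip w wL | ev C /minsetP[Cdep Cmin]]; last first.
  have [w /and3P[wL wC w0]|C0] :=
      pickP [pred w in L | (shadow b w \subset C) && (shadow b w != set0)].
    rewrite -(Cmin _ _ wC) ?ev //; apply: contraNN w0 => w_ind.
    by apply/eqP; apply: independent_shadow w_ind wL _.
  case/negP: Cdep; apply: shadow_independent => // w wL wC.
  by apply/eqP/negbFE; have := C0 w; rewrite /= wL wC.
have [n] := ubnP #|shadow b w|; elim: n w wL => // n IHn w wL wn.
have [->|w0] := eqVneq (shadow b w) set0; first by rewrite cards0.
have w_dep : ~~ independent (lower (feasible L a b)) (shadow b w).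
  by apply: contraNN w0 => w_ind; apply/eqP/(independent_shadow lagL ab w_ind).
have [C Ccirc Cw] := @minset_exists _
  (fun X => ~~ independent (lower (feasible L a b)) X) _ w_dep.
have /minsetP[Cdep Cmin] := Ccirc.
have [x /and3P[xL xC x0]|C0] :=
    pickP [pred x in L | (shadow b x \subset C) && (shadow b x != set0)];
  last first.
  case/negP: Cdep; apply: shadow_independent => // x xL xC.
  by apply/eqP/negbFE; have := C0 x; rewrite /= xL xC.
have xE : shadow b x = C.
  apply: Cmin xC; apply: contraNN x0 => x_ind.
  by apply/eqP; apply: independent_shadow x_ind xL _.
have wxE : shadow b (w + x) = shadow b w :\: C.
  rewrite shadowD xE /symdiff; have /eqP-> : C :\: shadow b w == set0.
    by rewrite setD_eq0.
  by rewrite setU0.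
have := cardsID C (shadow b w); rewrite (setIidPr Cw) => <-; rewrite oddD.
rewrite (negPf (bip C Ccirc)) -wxE; apply: IHn; first exact: lagrangianD.
apply: leq_trans (ltnSE wn); rewrite wxE; apply: proper_card.
apply/properP; split; first exact: subsetDl.
have /set0Pn[e ex] := x0; exists e; last by rewrite in_setD -xE ex.
by rewrite (subsetP Cw) // -xE.
Qed.

(** The third vectors are a e + b e for the frame (a, b) and a e for the frame
    (a + b, b); together they are the vectors not parallel to b e. *)
Lemma quad_shadow a b w :
  quad a b w + quad (fun e => a e + b e) b w = #|shadow b w|%:R.
Proof.
rewrite /quad -big_split -sum1_card natr_sum /= [RHS]big_mkcond /=.
apply: eq_bigr => e _; rewrite inE crossDr.
move: (cross (w e) (a e)) (cross (w e) (b e)) => x y.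
by case: (F2P x) => ->; case: (F2P y) => ->; apply/eqP.
Qed.

Lemma bipartite_feasible L a b :
    lagrangian L -> framed a b -> feasible L a b != set0 ->
    even_system (feasible L a b) ->
  bipartite (feasible L a b) <->
  (delta_matroid (loop_complement (feasible L a b) [set: E]) /\
   even_system (loop_complement (feasible L a b) [set: E])).
Proof.
move=> lagL ab D0 evD.
have D'0 := loop_complement_neq0 [set: E] D0.
apply: iff_trans (bipartite_shadow lagL ab D0) _.
rewrite loop_complement_feasible //.
rewrite loop_complement_feasible // in D'0.
have ab' : framed (fun e => a e + b e) b.
  by move=> e; rewrite crossDl crossvv addr0.
have shadowE w : w \in L ->
    ~~ odd #|shadow b w| = (quad (fun e => a e + b e) b w == 0).
  move=> wL; rewrite -F2_natr_eq0 -(quad_shadow a).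
  by rewrite (quad_eq0 lagL ab D0 evD wL) add0r.
split=> [ev | [_ evD'] w wL]; last first.
  by rewrite shadowE ?(quad_eq0 lagL ab' D'0 evD').
split; last by apply: quad_even => // w wL; apply/eqP; rewrite -shadowE ?ev.
by split=> //; apply: feasible_exchange.
Qed.

End Lagrangian.

(** * Delta-matroids of symmetric matrices *)

(** The kernel of a principal submatrix, read on vectors of full length that
    are supported on Y. *)
Lemma principal_unitmxP n (M : 'M['F_2]_n) (Y : {set 'I_n}) :
  reflect (forall x : 'rV_n, (forall i, i \notin Y -> x 0 i = 0) ->
             (forall i, i \in Y -> (x *m M) 0 i = 0) -> x = 0)
          (principal_submx M Y \in unitmx).
Proof.
have mulE (x : 'rV_n) (y : 'rV_#|Y|) : (forall i, i \notin Y -> x 0 i = 0) ->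
    (forall k, y 0 k = x 0 (enum_val k)) ->
    forall k, (y *m principal_submx M Y) 0 k = (x *m M) 0 (enum_val k).
  move=> xY yx k; rewrite !mxE [RHS](bigID (mem Y)) /= [X in _ + X]big1 ?addr0.
    rewrite [RHS]big_enum_val; apply: eq_bigr => j _.
    by rewrite !mxE yx.
  by move=> i iY; rewrite xY // mul0r.
rewrite -row_free_unit; apply: (iffP idP) => [free x xY xMY | inj].
  pose y := \row_k x 0 (enum_val k) : 'rV_#|Y|.
  have /eqP : y *m principal_submx M Y = 0.
    apply/rowP => k; rewrite (mulE x y xY) => [|j]; last by rewrite mxE.
    by rewrite xMY ?enum_valP // mxE.
  rewrite mulmx_free_eq0 // => /eqP/rowP y0; apply/rowP => i; rewrite mxE.
  have [iY|/xY//] := boolP (i \in Y).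
  by have := y0 (enum_rank_in iY i); rewrite !mxE enum_rankK_in.
apply: inj_row_free => y yM.
(* The sum has at most one term: it extends y by zero outside Y. *)
pose x := \row_i \sum_(k | enum_val k == i) y 0 k : 'rV_n.
have yx k : y 0 k = x 0 (enum_val k).
  rewrite mxE (big_pred1 k) // => j; exact: (inj_eq enum_val_inj).
have xY i : i \notin Y -> x 0 i = 0.
  move=> iY; rewrite mxE big_pred0 // => k.
  by apply: contraNF iY => /eqP <-; exact: enum_valP.
have x0 : x = 0.
  apply: inj => // i iY; rewrite -(enum_rankK_in iY iY).
  by rewrite -(mulE x y) // yM mxE.
by apply/rowP => k; rewrite yx x0 !mxE.
Qed.

Section Graph.

Variables (E : finType) (n : nat) (M : 'M['F_2]_n) (f : E -> 'I_n).
Hypotheses (M_sym : M^T = M) (f_bij : bijective f).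

Definition graph_vec (x : 'rV['F_2]_n) : {ffun E -> plane} :=
  [ffun e => (x 0 (f e), (x *m M) 0 (f e))].

Definition graph : {set {ffun E -> plane}} :=
  [set graph_vec x | x in [set: 'rV_n]].

Lemma graphP w : reflect (exists x, w = graph_vec x) (w \in graph).
Proof.
by apply: (iffP imsetP) => [[x _ ->]|[x ->]]; exists x; rewrite ?inE.
Qed.

Lemma graph_vec_inj : injective graph_vec.
Proof.
have [g _ gK] := f_bij => x y /ffunP xy; apply/rowP => i.
by have := xy (g i); rewrite !ffunE gK => -[].
Qed.

Lemma graph_lagrangian : lagrangian graph.
Proof.
split.
- move=> _ _ /graphP[x ->] /graphP[y ->]; apply/graphP; exists (x + y).
  by apply/ffunP => e; rewrite !ffunE mulmxDl ![(_ + _ : 'rV_n) 0 _]mxE.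
- move=> _ _ /graphP[x ->] /graphP[y ->].
  transitivity (\sum_i (x 0 i * (y *m M) 0 i + (x *m M) 0 i * y 0 i)).
    rewrite (reindex f) /=; last exact: onW_bij.
    by apply: eq_bigr => e _; rewrite /cross !ffunE.
  have dotE (u v : 'rV['F_2]_n) : \sum_i u 0 i * v 0 i = (u *m v^T) 0 0.
    by rewrite mxE; apply: eq_bigr => i _; rewrite mxE.
  rewrite big_split /= !dotE trmx_mul M_sym mulmxA; exact: F2_addxx.
rewrite card_imset; last exact: graph_vec_inj.
by rewrite cardsT card_mx card_Fp // mul1n -(card_ord n) (bij_eq_card f_bij).
Qed.

Lemma feasible_graph (X : {set E}) :
  (X \in feasible graph (fun=> (1, 0)) (fun=> (0, 1))) =
  (f @: X \in matrix_system M).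
Proof.
have [g fK gK] := f_bij; have f_inj := can_inj fK.
have crossE x e :
    cross (graph_vec x e) (choose X (fun=> (1, 0)) (fun=> (0, 1)) e) =
    if e \in X then (x *m M) 0 (f e) else x 0 (f e).
  rewrite /cross /choose ffunE.
  by case: ifP => _ /=; rewrite ?mulr0 ?mulr1 ?add0r ?addr0.
rewrite !inE; apply/transverseP/principal_unitmxP => [tr x xX xMX | inj].
  apply: graph_vec_inj.
  have -> : graph_vec 0 = 0.
    by apply/ffunP => e; rewrite !ffunE mul0mx !mxE.
  apply: tr; first by apply/graphP; exists x.
  apply/alongP => e; rewrite crossE; case: ifP => eX.
    by rewrite xMX // mem_imset.
  by rewrite xX // mem_imset // eX.
move=> _ /graphP[x ->] /alongP xX.
have -> : x = 0; last by apply/ffunP => e; rewrite !ffunE mul0mx !mxE.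
apply: inj => i; rewrite -(gK i) mem_imset // => iX.
  by have := xX (g i); rewrite crossE (negPf iX).
by have := xX (g i); rewrite crossE iX.
Qed.

End Graph.

Lemma binary_feasible (E : finType) (D : set_system E) :
  binary D -> exists (L : {set {ffun E -> plane}}) (a b : E -> plane),
    [/\ lagrangian L, framed a b & D = feasible L a b].
Proof.
move=> [A [n [M [M_sym [f f_bij fD]]]]].
pose a : E -> plane := fun=> (1, 0); pose b : E -> plane := fun=> (0, 1).
have ab : framed a b by move=> e; apply/eqP.
exists (graph M f), (choose A b a), (choose A a b).
split; [exact: graph_lagrangian | exact: framed_choose |].
rewrite -twist_feasible -[LHS](twistK D A); congr twist.
by apply/setP => X; rewrite fD (feasible_graph M f_bij).
Qed.

Theorem theorem9 (E : finType) (D : set_system E) :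
  delta_matroid D -> binary D -> even_system D ->
  bipartite D <->
  (delta_matroid (loop_complement D [set: E]) /\
   even_system (loop_complement D [set: E])).
Proof.
move=> [D0 _] /binary_feasible[L [a [b [lagL ab DE]]]] evD.
by rewrite DE in D0 evD *; apply: bipartite_feasible.
Qed.
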